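(* Let $k$ be an algebraically closed field, let $m,n,t$ be integers with $2\le t\le m\le n$, and put $r=t-1$, $V=k^n$, $W=k^m$, $E=k^r$. Let $M=\mathrm{Hom}(E,W)\times\mathrm{Hom}(V,E)$, with coordinate ring $T=k[w_{il},v_{lj}\mid 1\le i\le m,\ 1\le l\le r,\ 1\le j\le n]$, let $S=k[x_{ij}]_{1\le i\le m,\,1\le j\le n}$, and let $I_t\subset S$ be the ideal generated by all $t$-minors of the matrix $(x_{ij})$. Let $G=\mathrm{GL}(E)$ act on $M$ by $g\cdot(\varphi,\psi)=(\varphi g^{-1},g\psi)$. Then the $k$-algebra map $\phi^\#\colon S/I_t\to T$, $x_{ij}\mapsto\sum_{l=1}^{r}w_{il}v_{lj}$ (the map associated with the morphism $\pi\colon M\to Y_t=\mathrm{Spec}(S/I_t)$, $\pi(\varphi,\psi)=\varphi\circ\psi$) is injective, and its image is the ring of invariants $T^G$.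
   Context: $Y_t$ denotes the closed subscheme $\mathrm{Spec}(S/I_t)$ of $\mathrm{Hom}(V,W)=\mathrm{Spec}\,S$; its $k$-points are the linear maps $f\colon V\to W$ of rank $<t$. The variables $w_{il}$ and $v_{lj}$ are the matrix-entry coordinates on $\mathrm{Hom}(E,W)$ and $\mathrm{Hom}(V,E)$ respectively. The map $\phi^\#$ is well defined because a linear map factoring through the $r$-dimensional space $E$ has vanishing $t$-minors. $T^G$ is the subring of polynomial functions on $M$ that are invariant under the action of $G$. *)

(* Defs.v *)
From HB Require Import structures.
From mathcomp Require Import all_boot all_order all_algebra.
From mathcomp Require Import mpoly.
From mathcomp Require Import boolp.

Set Implicit Arguments.
Unset Strict Implicit.
Unset Printing Implicit Defensive.

Import GRing.Theory.
Local Open Scope ring_scope.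
Local Open Scope quotient_scope.

(* [p] is a finite sum of multiples of elements of [G]. *)
Definition in_ideal_gen (R : comNzRingType) (G : R -> Prop) (p : R) : Prop :=
  exists s : seq (R * R),
    (forall c, c \in s -> G c.2) /\ p = \sum_(c <- s) c.1 * c.2.

Lemma in_ideal_gen0 (R : comNzRingType) (G : R -> Prop) : in_ideal_gen G 0.
Proof. by exists [::]; rewrite big_nil. Qed.

Lemma in_ideal_genMD (R : comNzRingType) (G : R -> Prop) (a p q : R) :
  in_ideal_gen G p -> in_ideal_gen G q -> in_ideal_gen G (a * p + q).
Proof.
move=> [s [sG ->]] [s' [s'G ->]].
exists ([seq (a * c.1, c.2) | c <- s] ++ s'); split=> [c|].
  rewrite mem_cat => /orP[/mapP[d ds ->]|cs]; last exact: s'G.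
  exact: (sG d ds).
rewrite big_cat big_map mulr_sumr /=; congr (_ + _).
by apply: eq_bigr => c _; rewrite mulrA.
Qed.

Lemma in_ideal_gen_ker (R : comNzRingType) (S : nzRingType)
    (f : {rmorphism R -> S}) (G : R -> Prop) (p : R) :
  (forall q, G q -> f q = 0) -> in_ideal_gen G p -> f p = 0.
Proof.
move=> fG [s [sG ->]]; rewrite rmorph_sum big_seq big1 // => c cs.
by rewrite rmorphM (fG c.2) ?mulr0 //; exact: sG.
Qed.

Section DeterminantalRing.

Variables (k : fieldType) (m n t : nat).

Notation S := {mpoly k[m * n]}.

(* The index of x_ij is [mxvec_index i j], so that evaluating at [mxvec A 0]
   substitutes the entries of [A]. *)
Definition xvar (i : 'I_m) (j : 'I_n) : S := 'X_(mxvec_index i j).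

Definition is_minor (p : S) : Prop :=
  exists (f : 'I_t -> 'I_m) (g : 'I_t -> 'I_n),
    [/\ {homo f : a b / (a < b)%N}, {homo g : a b / (a < b)%N}
      & p = \det (\matrix_(a, b) xvar (f a) (g b))].

(* The argument [1 < t] makes the ideal proper (the 0-minor is 1), as required
   by the ideals of ring_quotient. *)
Definition det_ideal of (1 < t)%N : {pred S} :=
  fun p => `[< in_ideal_gen is_minor p >].

Variable t_gt1 : (1 < t)%N.

Lemma det_ideal_closed : idealr_closed (det_ideal t_gt1).
Proof.
split; first exact/asboolP/in_ideal_gen0.
- apply/negP => /asboolP /(@in_ideal_gen_ker _ _ (meval (fun=> 0 : k))) h.
  have /eqP : meval (fun=> 0 : k) (1 : S) = 0.
    apply: h => q [f [g [_ _ ->]]].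
    rewrite -det_map_mx; apply/eqP/det0P; exists (const_mx 1).
      apply/eqP => /rowP /(_ (Ordinal (ltnW t_gt1))).
      by rewrite !mxE => /eqP; rewrite oner_eq0.
    apply/rowP => b; rewrite !mxE big1 // => a _.
    by rewrite !mxE /= mevalXU mulr0.
  by rewrite meval1 oner_eq0.
- move=> a p q /asboolP Ip /asboolP Iq.
  exact/asboolP/in_ideal_genMD.
Qed.

HB.instance Definition _ := isIdealr.Build S (det_ideal t_gt1) det_ideal_closed.

Definition det_ring : Type := {ideal_quot (det_ideal t_gt1)}.
HB.instance Definition _ := GRing.ComNzRing.on det_ring.

Definition det_pi (p : S) : det_ring := \pi_{ideal_quot (det_ideal t_gt1)} p.

HB.instance Definition _ :=
  GRing.isZmodMorphism.Build S det_ring det_pi (@pi_is_zmod_morphism _ _ _ _).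
HB.instance Definition _ :=
  GRing.isMonoidMorphism.Build S det_ring det_pi (@pi_is_monoid_morphism _ _ _ _).

Definition det_repr (q : det_ring) : S :=
  repr (q : {ideal_quot (det_ideal t_gt1)}).

Lemma det_reprK : cancel det_repr det_pi. Proof. exact: reprK. Qed.

Lemma det_pi_eq (p q : S) :
  det_pi p = det_pi q <-> in_ideal_gen is_minor (p - q).
Proof.
split=> [/eqP | h].
  by rewrite -Quotient.idealrBE => /asboolP.
by apply/eqP; rewrite -Quotient.idealrBE; apply/asboolP.
Qed.

Definition det_scale (a : k) (q : det_ring) : det_ring := det_pi a%:MP * q.

Lemma det_scaleA a b q : det_scale a (det_scale b q) = det_scale (a * b) q.
Proof. by rewrite /det_scale mulrA -rmorphM -mpolyCM. Qed.
Lemma det_scale1 : left_id 1 det_scale.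
Proof. by move=> q; rewrite /det_scale rmorph1 mul1r. Qed.
Lemma det_scaleDr : right_distributive det_scale +%R.
Proof. by move=> a p q; rewrite /det_scale mulrDr. Qed.
Lemma det_scaleDl q : {morph det_scale^~ q : a b / a + b}.
Proof. by move=> a b; rewrite /det_scale mpolyCD rmorphD mulrDl. Qed.

HB.instance Definition _ := GRing.Zmodule_isLmodule.Build k det_ring
  det_scaleA det_scale1 det_scaleDr det_scaleDl.

Lemma det_scaleAl (a : k) (p q : det_ring) : a *: (p * q) = a *: p * q.
Proof. exact: mulrA. Qed.

HB.instance Definition _ := GRing.Lmodule_isLalgebra.Build k det_ring det_scaleAl.
HB.instance Definition _ := GRing.Lalgebra_isComAlgebra.Build k det_ring.

Lemma det_pi_scalable : scalable det_pi.
Proof. by move=> a p; rewrite -mul_mpolyC rmorphM. Qed.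
HB.instance Definition _ :=
  GRing.isScalable.Build k S det_ring _ det_pi det_pi_scalable.

End DeterminantalRing.

Section Factorization.

Variables (k : fieldType) (m n r : nat).

Notation S := {mpoly k[m * n]}.

(* The coordinate ring of M = Hom(E, W) x Hom(V, E), with the coordinates of
   the first factor numbered before those of the second. *)
Notation T := {mpoly k[m * r + r * n]}.
Notation M := ('M[k]_(m, r) * 'M[k]_(r, n))%type.

Definition wvar (i : 'I_m) (l : 'I_r) : T := 'X_(lshift _ (mxvec_index i l)).
Definition vvar (l : 'I_r) (j : 'I_n) : T := 'X_(rshift _ (mxvec_index l j)).

Definition subst_mul : S -> T :=
  comp_mpoly [tuple mxvec (\matrix_(i, j) \sum_(l < r) wvar i l * vvar l j) 0 a
             | a < m * n].

HB.instance Definition _ := GRing.LRMorphism.on subst_mul.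

Lemma subst_mulX i j : subst_mul (xvar k i j) = \sum_(l < r) wvar i l * vvar l j.
Proof. by rewrite /subst_mul comp_mpolyXU -tnth_nth tnth_mktuple mxvecE mxE. Qed.

Lemma subst_mul_minor t (q : S) : (r < t)%N -> is_minor t q -> subst_mul q = 0.
Proof.
move=> lt_rt [f [g [_ _ ->]]]; rewrite -det_map_mx.
pose A := \matrix_(a < t, l < t) if insub (l : nat) is Some l' then wvar (f a) l' else 0.
pose B := \matrix_(l < t, b < t) if insub (l : nat) is Some l' then vvar l' (g b) else 0.
have -> : map_mx subst_mul (\matrix_(a, b) xvar k (f a) (g b)) = A *m B.
  apply/matrixP => a b; rewrite !mxE subst_mulX.
  pose F l := if insub l is Some l' then wvar (f a) l' * vvar l' (g b) else 0.
  rewrite (eq_bigr (F \o val)) => [|l _]; last by rewrite /F /= valK.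
  rewrite (big_ord_widen t F (ltnW lt_rt)) big_mkcond; apply: eq_bigr => l _.
  by rewrite !mxE /F; case: insubP => [l' -> _|/negPf ->]; rewrite ?mul0r.
rewrite det_mulmx (expand_det_col A (Ordinal lt_rt)) big1 ?mul0r // => a _.
by rewrite !mxE insubF ?ltnn ?mul0r.
Qed.

Definition coords (x : M) (a : 'I_(m * r + r * n)) : k :=
  row_mx (mxvec x.1) (mxvec x.2) 0 a.

(* [g] ranges over all matrices; this is the action of GL(E) when
   [g \in unitmx]. *)
Definition GLact (g : 'M[k]_r) (x : M) : M := (x.1 *m invmx g, g *m x.2).

(* Invariance as a function on the points of M; over an infinite field this
   determines the polynomial. *)
Definition GLinvariants : {pred T} :=
  fun p => `[< forall g : 'M[k]_r, g \in unitmx ->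
               forall x : M, p.@[coords (GLact g x)] = p.@[coords x] >].

Lemma GLinvariants_subalg : subalg_closed GLinvariants.
Proof.
split=> [|a p q /asboolP Ip /asboolP Iq|p q /asboolP Ip /asboolP Iq];
  apply/asboolP => g gU x.
- by rewrite !meval1.
- by rewrite !mevalD !mevalZ Ip ?Iq.
- by rewrite !mevalM Ip ?Iq.
Qed.

HB.instance Definition _ :=
  GRing.isSubalgClosed.Build k T GLinvariants GLinvariants_subalg.

Definition comp_map (x : M) : 'M[k]_(m, n) := x.1 *m x.2.

Lemma subst_mul_eval (p : S) (x : M) :
  (subst_mul p).@[coords x] = p.@[fun a => mxvec (comp_map x) 0 a].
Proof.
rewrite /subst_mul comp_mpoly_meval; apply: meval_eq => a.
rewrite tnth_mktuple; case/mxvec_indexP: a => i j.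
rewrite !mxvecE !mxE rmorph_sum; apply: eq_bigr => l _.
by rewrite rmorphM /= !mevalXU /coords row_mxEl row_mxEr !mxvecE.
Qed.

End Factorization.

Section PhiSharp.

Variables (k : fieldType) (m n t : nat) (t_gt1 : (1 < t)%N).

Notation S := {mpoly k[m * n]}.
Notation T := {mpoly k[m * t.-1 + t.-1 * n]}.
Notation R := (det_ring k m n t_gt1).

(* The definition picks a representative; phi_sharp_pi shows that the choice is
   irrelevant. *)
Definition phi_sharp (q : R) : T := subst_mul _ (det_repr q).

Lemma phi_sharp_pi (p : S) : phi_sharp (det_pi t_gt1 p) = subst_mul _ p.
Proof.
apply/eqP; rewrite -subr_eq0 -rmorphB; apply/eqP.
have : in_ideal_gen (@is_minor k m n t) (det_repr (det_pi t_gt1 p) - p).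
  by apply/(det_pi_eq t_gt1); rewrite det_reprK.
apply: in_ideal_gen_ker => q; apply: subst_mul_minor.
by rewrite ltn_predL ltnW.
Qed.

Lemma phi_sharp_zmod : zmod_morphism phi_sharp.
Proof.
move=> p q; rewrite -[p]det_reprK -[q]det_reprK -rmorphB.
by rewrite !phi_sharp_pi rmorphB.
Qed.

Lemma phi_sharp_monoid : monoid_morphism phi_sharp.
Proof.
split=> [|p q]; first by rewrite -(rmorph1 (det_pi t_gt1)) phi_sharp_pi rmorph1.
rewrite -[p]det_reprK -[q]det_reprK -rmorphM.
by rewrite !phi_sharp_pi rmorphM.
Qed.

Lemma phi_sharp_scalable : scalable phi_sharp.
Proof.
by move=> a p; rewrite -[p]det_reprK -linearZ /= !phi_sharp_pi linearZ.
Qed.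

HB.instance Definition _ := GRing.isZmodMorphism.Build R T phi_sharp phi_sharp_zmod.
HB.instance Definition _ :=
  GRing.isMonoidMorphism.Build R T phi_sharp phi_sharp_monoid.
HB.instance Definition _ :=
  GRing.isScalable.Build k R T _ phi_sharp phi_sharp_scalable.

Lemma phi_sharpX i j :
  phi_sharp (det_pi t_gt1 (xvar k i j)) = \sum_(l < t.-1) wvar k n i l * vvar k m l j.
Proof. by rewrite phi_sharp_pi subst_mulX. Qed.

Lemma phi_sharp_eval (p : S) x :
  (phi_sharp (det_pi t_gt1 p)).@[coords x] = p.@[fun a => mxvec (comp_map x) 0 a].
Proof. by rewrite phi_sharp_pi subst_mul_eval. Qed.

End PhiSharp.

(* Main.v *)
Require Import Defs.
From HB Require Import structures.
From mathcomp Require Import all_boot all_order all_fingroup all_algebra.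
From mathcomp Require Import mpoly boolp zify.

Set Implicit Arguments.
Unset Strict Implicit.
Unset Printing Implicit Defensive.

Import Order.TTheory GRing.Theory.

(** Put r = t - 1, let X = (x_ij), and let phi_r be the substitution X := W V
    with W of size m x r and V of size r x n.  The two claims are the second
    and the first fundamental theorem for GL_r, in every characteristic: the
    kernel of phi_r is generated by the (r+1)-minors of X, and the image of
    phi_r is the ring of invariants.  Both follow from a k-basis of k[X] made
    of standard bideterminants, that is of products of minors
    [A_c | B_c] over the columns c of two semistandard tableaux A, B of equal
    shape.

    Leading monomials.  If the size l of a minor [A | B] is at most r, then the
    leading monomial of phi_r [A | B] is the product over a < l of
    w_(A a, a) v_(a, B a) (mlead_subst_minor).  Hence, if all the columns of a
    standard bideterminant have length at most r, the exponent of w_(i,a) in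
    its leading monomial is the number of i's in row a of A, and likewise for B
    and the v's (mlead_bidet); the leading monomial determines A and B.  So the
    images of these standard bideterminants are linearly independent.

    Spanning.  Taking r = m, the standard bideterminants are independent in
    k[X], so it suffices to have enough of them in each degree.  The
    Robinson-Schensted-Knuth correspondence supplies one for each monomial of
    k[X], of the same degree; only its injectivity matters.  It is set up here
    as a growth diagram: an array of partitions is filled by a local rule that
    can be inverted, so its boundary, which encodes (A, B), determines the
    exponents of the monomial (growth_inj).  A square matrix with independent
    rows is invertible, which gives bidet_span.

    Kernel.  A standard bideterminant with a column of length greater than r
    lies in the ideal of (r+1)-minors, and the others stay independent under
    phi_r; hence subst_mul_kernel.

    Invariants.  Let delta be the minor of X on its first r rows and columns.
    Where delta does not vanish at X = W V, the upper square block W1 of W is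
    invertible, and an invariant p satisfies p(W, V) = p(W W1^-1, W1 V).  With
    X1 the first r columns of X and X11 its corner block, W W1^-1 = X1 X11^-1,
    and W1 V consists of the first r rows of X.  So (phi_r delta)^e p is in the
    image of phi_r for some e (localised_eval).  It remains to cancel
    phi_r delta (subst_mul_cancel): if (phi_r delta) h is in the image, its
    leading monomial is that of a standard bideterminant and is divisible by
    all the w_(a,a) v_(a,a) with a < r.  The first column of both tableaux is
    then (0, ..., r-1), so delta is a factor of this bideterminant;
    subtracting it shortens the expansion, and induction applies. *)

(** * Growth diagrams *)

(** Partitions are functions from nat to nat: lam a is the length of row a. *)
(** The boxes of nu outside of mu form a horizontal strip: at most one in each
    column. *)
Definition hstrip (mu nu : nat -> nat) := forall a, nu a.+1 <= mu a <= nu a.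

(** The piecewise-linear form of Knuth insertion on a unit square of a growth
    diagram: lam is the corner nearest the origin, mu and nu are its two
    neighbours, x is the entry of the square. *)
Definition local_rule (lam mu nu : nat -> nat) (x a : nat) : nat :=
  if a is b.+1 then maxn (mu a) (nu a) + (minn (mu b) (nu b) - lam b)
  else maxn (mu 0) (nu 0) + x.

Lemma local_rule_hstrip lam mu nu x :
    hstrip lam mu -> hstrip lam nu ->
  hstrip mu (local_rule lam mu nu x) /\ hstrip nu (local_rule lam mu nu x).
Proof.
move=> lm ln; split=> -[|a] /=.
- by move: (lm 0) (ln 0); lia.
- by move: (lm a) (ln a) (lm a.+1) (ln a.+1); lia.
- by move: (lm 0) (ln 0); lia.
- by move: (lm a) (ln a) (lm a.+1) (ln a.+1); lia.
Qed.

(** Given mu and nu, the rule can be run backwards: minn (mu b) (nu b) - lam b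
    is recovered from row b.+1 and is not truncated, since lam interlaces with
    both mu and nu; x is recovered from row 0. *)
Lemma local_rule_inj lam mu nu x lam' mu' nu' x' :
    hstrip lam mu -> hstrip lam nu -> hstrip lam' mu' -> hstrip lam' nu' ->
    mu =1 mu' -> nu =1 nu' ->
    local_rule lam mu nu x =1 local_rule lam' mu' nu' x' ->
  lam =1 lam' /\ x = x'.
Proof.
move=> lm ln lm' ln' em en er; split=> [a|].
  by have := er a.+1; move: (lm a) (ln a) (lm' a) (ln' a); rewrite /= !em !en; lia.
by have := er 0; rewrite /= !em !en; lia.
Qed.

(** Row by row, a maximum and a minimum of the same pair add up to its sum. *)
Lemma local_rule_sum lam mu nu x K :
    hstrip lam mu -> hstrip lam nu -> mu K = 0 -> nu K = 0 ->
  \sum_(0 <= a < K.+1) local_rule lam mu nu x a + \sum_(0 <= a < K.+1) lam a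
  = \sum_(0 <= a < K.+1) mu a + \sum_(0 <= a < K.+1) nu a + x.
Proof.
move=> lm ln m0 n0.
have l0 : lam K = 0 by move: (lm K); lia.
(* Row k of mu and nu has so far contributed its maximum only. *)
have main k :
    \sum_(0 <= a < k.+1) local_rule lam mu nu x a + \sum_(0 <= a < k) lam a
    = \sum_(0 <= a < k) mu a + \sum_(0 <= a < k) nu a + maxn (mu k) (nu k) + x.
  elim: k => [|k IH]; first by rewrite big_nat1 !big_geq //= addn0.
  rewrite big_nat_recr //= [\sum_(_ <= _ < k.+1) lam _]big_nat_recr //=.
  rewrite [\sum_(_ <= _ < k.+1) mu _]big_nat_recr //=.
  rewrite [\sum_(_ <= _ < k.+1) nu _]big_nat_recr //=.
  by move: IH (lm k) (ln k); lia.
rewrite [\sum_(_ <= _ < K.+1) lam _]big_nat_recr //=.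
rewrite [\sum_(_ <= _ < K.+1) mu _]big_nat_recr //=.
rewrite [\sum_(_ <= _ < K.+1) nu _]big_nat_recr //=.
by have := main K; lia.
Qed.

(** The vertex (i, j) is the far corner of the square of the entry N i.-1 j.-1;
    on the two axes the partition is empty. *)
Fixpoint growth (N : nat -> nat -> nat) (i : nat) : nat -> nat -> nat :=
  if i is h.+1 then
    fix row j := if j is l.+1
      then local_rule (growth N h l) (row l) (growth N h l.+1) (N h l)
      else fun=> 0
  else fun _ _ => 0.

Arguments growth : simpl never.

Lemma growthSS N i j : growth N i.+1 j.+1 =
  local_rule (growth N i j) (growth N i.+1 j) (growth N i j.+1) (N i j).
Proof. by []. Qed.

Lemma growth0 N i : growth N i 0 =1 fun=> 0.
Proof. by case: i. Qed.

Lemma growth_hstrip N i j :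
  hstrip (growth N i j) (growth N i.+1 j) /\ hstrip (growth N i j) (growth N i j.+1).
Proof.
have A i' : (forall j, hstrip (growth N i' j) (growth N i' j.+1)) ->
    forall j, hstrip (growth N i' j) (growth N i'.+1 j).
  move=> B; elim=> [|l IH]; first by move=> a; rewrite !growth0.
  by rewrite growthSS; have [] := local_rule_hstrip (N i' l) IH (B l).
have B : forall i j, hstrip (growth N i j) (growth N i j.+1).
  elim=> [//|h IH] l.
  by rewrite growthSS; have [] := local_rule_hstrip (N h l) (A h IH l) (IH l).
by split; [apply: A | apply: B].
Qed.

(** The injectivity of the Robinson-Schensted-Knuth correspondence: the local
    rule is inverted square by square, from the far corner inwards. *)
Lemma growth_inj N N' m n :
    (forall i, i <= m -> growth N i n =1 growth N' i n) ->
    (forall j, j <= n -> growth N m j =1 growth N' m j) ->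
  forall i j, i < m -> j < n -> N i j = N' i j.
Proof.
elim: m => [//|m IH] right top.
(* Row m is recovered from row m.+1, from column n down to column 0. *)
have step j : j <= n -> growth N m j =1 growth N' m j /\
    (j < n -> N m j = N' m j).
  move=> le_jn; rewrite -(subKn le_jn); move: (n - j) (leq_subr j n) => d.
  elim: d => [|d IHd] le_dn.
    by rewrite subn0 ltnn; split=> //; apply: right.
  have [ih _] := IHd (ltnW le_dn).
  have Sd : (n - d.+1).+1 = n - d by lia.
  have := top (n - d) (leq_subr _ _); rewrite -Sd !growthSS => er.
  have [hA hB] := growth_hstrip N m (n - d.+1).
  have [hA' hB'] := growth_hstrip N' m (n - d.+1).
  have le : n - d.+1 <= n by rewrite leq_subr.
  rewrite -Sd in ih.
  by have [] := local_rule_inj hA hB hA' hB' (top _ le) ih er.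
move=> i j; rewrite ltnS leq_eqVlt => /orP[/eqP-> lt_jn|].
  by have [_ ->] := step j (ltnW lt_jn).
apply: IH => [i' le|j' le]; first by apply: right; apply: leqW.
by have [] := step j' le.
Qed.

Lemma growth_supp N i j a : i <= a -> growth N i j a = 0.
Proof.
elim: a i => [|a IH] [|i] // le; have [h _] := growth_hstrip N i j.
by move: (h a); rewrite IH //; lia.
Qed.

Lemma growth_sum N m i j : i <= m ->
  \sum_(0 <= a < m.+1) growth N i j a
  = \sum_(0 <= h < i) \sum_(0 <= l < j) N h l.
Proof.
elim: i j => [|i IHi] j; first by rewrite [RHS]big_geq // big1_eq.
elim: j => [|j IHj] lim.
  by rewrite !big1 // => *; rewrite ?growth0 // big_geq.
have [hA hB] := growth_hstrip N i j.
have z1 : growth N i.+1 j m = 0 by rewrite growth_supp.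
have z2 : growth N i j.+1 m = 0 by rewrite growth_supp // ltnW.
have := local_rule_sum (N i j) hA hB z1 z2; rewrite -growthSS.
rewrite IHj // !IHi ?(ltnW lim) // !big_nat_recr //=.
by lia.
Qed.

(** * Semistandard tableaux as chains of partitions *)

(** A semistandard tableau is encoded by the shapes P i formed by its entries
    smaller than i. *)
Definition gelfand_tsetlin (P : nat -> nat -> nat) :=
  P 0 =1 (fun=> 0) /\ forall i, hstrip (P i) (P i.+1).

Lemma find_iota_le (p : pred nat) m i :
  {homo p : a b / a <= b >-> (a ==> b)} -> i < m ->
  (find p (iota 0 m) <= i) = p i.
Proof.
move=> hp lt_im; apply/idP/idP => [le|pi].
  have hs : has p (iota 0 m) by rewrite has_find size_iota (leq_ltn_trans le).
  have := nth_find 0 hs; rewrite nth_iota ?add0n; last first.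
    by rewrite -[X in _ < X](size_iota 0) -has_find.
  exact/implyP/hp.
by rewrite leqNgt; apply/negP => /(before_find 0); rewrite nth_iota // pi.
Qed.

(** The length of column c of lam, when lam has at most m rows. *)
Definition conjugate (lam : nat -> nat) (m c : nat) :=
  find (fun a => lam a <= c) (iota 0 m).

(** The entry in row a and column c of the tableau of P m; the value is m
    outside of the shape. *)
Definition entry (P : nat -> nat -> nat) (m c a : nat) :=
  find (fun i => c < P i.+1 a) (iota 0 m).

Lemma conjugate_le lam m c : conjugate lam m c <= m.
Proof. by rewrite -[X in _ <= X](size_iota 0) find_size. Qed.

Section Chain.

Variables (P : nat -> nat -> nat).
Hypothesis chainP : gelfand_tsetlin P.

Lemma chain_homo a : {homo P^~ a : i j / i <= j}.
Proof.
apply: homo_leq => [//|x y z|i]; first exact: leq_trans.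
by have /andP[] := chainP.2 i a.
Qed.

Lemma chain_nonincr i : {homo P i : a b / a <= b >-> b <= a}.
Proof.
apply: homo_leq => [//|x y z /[swap]|a]; first exact: leq_trans.
by have /andP[h1 h2] := chainP.2 i a; have := chain_homo a.+1 (leqnSn i); lia.
Qed.

Lemma chain_supp i a : i <= a -> P i a = 0.
Proof.
elim: a i => [|a IH] [|i] // le; rewrite ?chainP.1 //.
by move: (chainP.2 i a); rewrite IH //; lia.
Qed.

Lemma chain_strip i a b : a < b -> P i.+1 b <= P i a.
Proof.
move=> lt; apply: leq_trans (chain_nonincr i.+1 lt) _.
by have /andP[] := chainP.2 i a.
Qed.

Lemma conjugate_gt m c a : (a < conjugate (P m) m c) = (c < P m a).
Proof.
have [lt_am|le_ma] := ltnP a m; last first.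
  by rewrite chain_supp // ltn0 ltnNge (leq_trans (conjugate_le _ _ _)).
rewrite ltnNge [conjugate _ _ _ <= a]find_iota_le -?ltnNge // => x y /chain_nonincr h.
by apply/implyP; apply: leq_trans.
Qed.

Lemma entry_le m c a i : i < m -> (entry P m c a <= i) = (c < P i.+1 a).
Proof.
move=> lt; rewrite [LHS]find_iota_le // => x y le.
by apply/implyP => /leq_trans; apply; apply: chain_homo.
Qed.

Lemma entry_lt m c a : c < P m a -> entry P m c a < m.
Proof. by case: m => [|m]; rewrite ?chainP.1 // ltnS entry_le. Qed.

Lemma entry_eq m c a i : i < m ->
  (entry P m c a == i) = (P i a <= c < P i.+1 a).
Proof.
case: i => [|i] lt; first by rewrite -leqn0 entry_le // chainP.1.
rewrite eqn_leq entry_le // andbC; congr (_ && _).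
by rewrite ltnNge entry_le -?leqNgt // ltnW.
Qed.

(** The columns of a semistandard tableau increase strictly, because the step
    from P i to P i.+1 adds at most one box to a column. *)
Lemma entry_mono m c a b : a < b -> c < P m b -> entry P m c a < entry P m c b.
Proof.
move=> lt_ab cb.
have ca : c < P m a by apply: leq_trans cb (chain_nonincr m (ltnW lt_ab)).
have em := entry_lt ca; rewrite ltnNge entry_le //; apply/negP => h.
have := leq_trans h (chain_strip (entry P m c a) lt_ab).
by have := entry_eq c a em; rewrite eqxx => /esym/andP[/leq_gtF->].
Qed.

(** Columns increase strictly from 0 on, so the entry in row a is at least a;
    it is a as soon as row a contains an a. *)
Lemma entry_diag m a : a < m -> 0 < P a.+1 a -> entry P m 0 a = a.
Proof. by move=> lt pos; apply/eqP; rewrite entry_eq // chain_supp. Qed.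

End Chain.

Lemma sum_interval (p q K : nat) : p <= q -> q <= K ->
  (\sum_(c < K) (p <= c < q) = q - p)%N.
Proof.
move=> pq qK.
rewrite -(big_mkord predT (fun c => nat_of_bool (p <= c < q))).
rewrite (big_cat_nat (leq0n q) qK) (big_cat_nat (leq0n p) pq) /=.
rewrite big_nat_cond big1 => [|i]; last by lia.
rewrite [X in _ + X]big_nat_cond [X in _ + X]big1 => [|i]; last by lia.
rewrite big_nat (eq_bigr (fun=> 1)) => [|i ->//].
by rewrite -big_nat sum_nat_const_nat; lia.
Qed.

Local Open Scope ring_scope.

(** * Leading monomials of minors of a product *)

Lemma index_allpairs (S T : eqType) (s : seq S) (t : seq T) x y :
  x \in s -> y \in t ->
  index (x, y) [seq (a, b) | a <- s, b <- t] = (index x s * size t + index y t)%N.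
Proof.
move=> + yt; elim: s => //= z s IH; rewrite inE index_cat eq_sym.
case: eqP => [-> _|/eqP zx] /=.
  rewrite map_f // index_map //; by move=> a b [].
move=> xs; case: ifP => [/mapP[b _ [exz]]|_]; first by rewrite exz eqxx in zx.
by rewrite size_map IH // mulSn addnA.
Qed.

Lemma mxvec_index_val m n (i : 'I_m) (j : 'I_n) :
  mxvec_index i j = (i * n + j)%N :> nat.
Proof.
rewrite /= /enum_rank [enum_rank_in]unlock insubdK; last first.
  by rewrite unfold_in cardE index_mem mem_enum.
rewrite enumT unlock /= index_allpairs ?mem_enum //.
by rewrite -cardE card_ord !index_enum_ord.
Qed.

(** Matrix coordinates are numbered in lexicographic order, so the monomial
    order makes w_00 > w_01 > ... > w_10 > ... and places the w before the v. *)
Lemma mxvec_index_ltn m n (i i' : 'I_m) (j j' : 'I_n) :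
  (mxvec_index i j < mxvec_index i' j')%N
  = (i < i')%N || (i == i') && (j < j')%N.
Proof.
rewrite !mxvec_index_val; have [lt|gt|/val_inj->] /= := ltngtP i i'.
- apply: leq_trans (leq_addr _ _); apply: leq_trans (_ : i.+1 * n <= _)%N.
    by rewrite mulSn addnC ltn_add2r.
  by rewrite leq_mul2r lt orbT.
- rewrite gt_eqF // ltnNge; apply/negbTE/negPn/ltnW.
  apply: leq_trans (leq_addr _ _); apply: leq_trans (_ : i'.+1 * n <= _)%N.
    by rewrite mulSn addnC ltn_add2r.
  by rewrite leq_mul2r gt orbT.
- by rewrite eqxx ltn_add2l.
Qed.

Lemma mxvec_index_eq m n (i i' : 'I_m) (j j' : 'I_n) :
  (mxvec_index i j == mxvec_index i' j') = (i == i') && (j == j').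
Proof. by rewrite (inj_eq (@cast_ord_inj _ _ _)) (inj_eq enum_rank_inj). Qed.

Lemma mlead_monic n (R : nzRingType) (p : {mpoly R[n]}) (D : 'X_{1..n}) :
  p@_D = 1 -> (forall m, m \in msupp p -> m <= D)%O -> mlead p = D.
Proof.
move=> pD le; apply/le_anti/andP; split.
  have p0 : p != 0 by apply: contra_eq_neq pD => ->; rewrite mcoeff0 eq_sym oner_neq0.
  exact/le/mlead_supp.
by apply: msupp_le_mlead; rewrite mcoeff_msupp pD oner_neq0.
Qed.

Section Minor.

Variables (k : fieldType) (m n r l : nat).
Variables (f : 'I_l -> 'I_m) (g : 'I_l -> 'I_n) (le_lr : (l <= r)%N).

Notation T := {mpoly k[m * r + r * n]}.

Definition windex (i : 'I_m) (c : 'I_r) : 'I_(m * r + r * n) :=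
  lshift _ (mxvec_index i c).
Definition vindex (c : 'I_r) (j : 'I_n) : 'I_(m * r + r * n) :=
  rshift _ (mxvec_index c j).

Lemma wvindexP (P : 'I_(m * r + r * n) -> Prop) :
  (forall i c, P (windex i c)) -> (forall c j, P (vindex c j)) -> forall x, P x.
Proof.
by move=> Pw Pv x; rewrite -(splitK x); case: (split x) => y /=;
  case/mxvec_indexP: y.
Qed.

(** By multilinearity the minor expands into terms indexed by a choice h of
    summation indices and a permutation s; this is the monomial of such a
    term. *)
Definition term_mnm (h : 'I_l -> 'I_r) (s : 'I_l -> 'I_l) : 'X_{1..m * r + r * n} :=
  (\sum_a (U_(windex (f a) (h a)) + U_(vindex (h a) (g (s a)))))%MM.

Lemma term_mnm_w h s i c :
  term_mnm h s (windex i c) = (\sum_a ((f a == i) && (h a == c)))%N.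
Proof.
rewrite mnm_sumE; apply: eq_bigr => a _; rewrite mnmDE !mnm1E.
by rewrite eq_rlshift addn0 (inj_eq (@lshift_inj _ _)) mxvec_index_eq.
Qed.

Lemma term_mnm_v h s c j :
  term_mnm h s (vindex c j) = (\sum_a ((h a == c) && (g (s a) == j)))%N.
Proof.
rewrite mnm_sumE; apply: eq_bigr => a _; rewrite mnmDE !mnm1E.
by rewrite eq_lrshift add0n (inj_eq (@rshift_inj _ _)) mxvec_index_eq.
Qed.

Lemma mdeg_term_mnm h s : mdeg (term_mnm h s) = (l * 2)%N.
Proof.
rewrite mdeg_sum (eq_bigr (fun=> 2%N)) => [|a _]; last by rewrite mdegD !mdeg1.
by rewrite sum_nat_const card_ord.
Qed.

Definition diag_mnm := term_mnm (widen_ord le_lr) id.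

Hypotheses (f_homo : {homo f : a b / (a < b)%N}).
Hypotheses (g_homo : {homo g : a b / (a < b)%N}).

(** At the first a with h a != a, injectivity of h forces h a > a, so the term
    lacks w_(f a, a) while all earlier exponents agree.  If h is the inclusion,
    the first a with s a != a plays this role for v_(a, g a). *)
Lemma term_mnm_lt (h : 'I_l -> 'I_r) (s : {perm 'I_l}) : injective h ->
  ~~ [forall a, (h a == widen_ord le_lr a) && (s a == a)] ->
  (term_mnm h s < diag_mnm)%O.
Proof.
move=> h_inj nid; apply/ltmcP; first by rewrite !mdeg_term_mnm.
have first_diff (q : pred 'I_l) : ~~ [forall a, q a] ->
    exists2 a, ~~ q a & forall b : 'I_l, (b < a)%N -> q b.
  rewrite negb_forall => /existsP[x qx].
  case: (@arg_minnP _ x (predC q) val qx) => a qa amin.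
  by exists a => // b; apply: contraTT => /amin; rewrite -leqNgt.
have inj_gt (s' : 'I_l -> nat) a : injective s' -> s' a != a ->
    (forall b : 'I_l, (b < a)%N -> s' b = b) -> (a < s' a)%N.
  move=> s'_inj neq agree; rewrite ltnNge leq_eqVlt negb_or neq /=.
  apply/negP => lt; have lt' := ltn_trans lt (ltn_ord a).
  have /(congr1 val)/= eqa := s'_inj _ _ (agree (Ordinal lt') lt).
  by rewrite eqa eqxx in neq.
have [/forallP hid|/first_diff[a ha hlt]] :=
    boolP [forall a, h a == widen_ord le_lr a].
  have {}hid a : h a = widen_ord le_lr a by apply/eqP.
  have /first_diff[a sa slt] : ~~ [forall a, s a == a].
    apply: contra nid => /forallP sid; apply/forallP => a.
    by rewrite hid sid eqxx.
  have {}sa : (a < s a)%N.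
    by apply: (inj_gt (val \o s)) => // [x y /val_inj/perm_inj//|b /slt/eqP/= ->].
  exists (vindex (widen_ord le_lr a) (g a)).
    elim/wvindexP => [i c|c j] lt.
      by rewrite !term_mnm_w; apply: eq_bigr => b _; rewrite hid.
    rewrite !term_mnm_v; apply: eq_bigr => b _; rewrite hid.
    case: eqP => //= cb; congr nat_of_bool.
    move: lt; rewrite ltn_add2l mxvec_index_ltn -cb -val_eqE /=.
    have [/slt/eqP->//|lt|/val_inj->] //= := ltngtP b a.
    move=> gj; rewrite -!val_eqE /= !gtn_eqF //; last first.
      by apply: ltn_trans gj _; apply: g_homo.
  rewrite [X in (_ < X)%N]term_mnm_v (bigD1 a) //= !eqxx.
  rewrite term_mnm_v big1 // => b _; rewrite hid -val_eqE /=.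
  case: eqP => // /val_inj->; rewrite -val_eqE /= gtn_eqF //; exact: g_homo.
have {}ha : (a < h a)%N.
  by apply: (inj_gt (val \o h)) => // [x y /val_inj/h_inj//|b /hlt/eqP/= ->].
exists (windex (f a) (widen_ord le_lr a)).
  elim/wvindexP => [i c|c j] lt; last first.
    have := ltn_trans lt (ltn_ord (mxvec_index (f a) (widen_ord le_lr a))).
    by rewrite ltnNge leq_addr.
  rewrite !term_mnm_w; apply: eq_bigr => b _.
  case: eqP => //= fi; congr nat_of_bool.
  move: lt; rewrite /= mxvec_index_ltn -fi.
  have [/hlt/eqP->//|lt|/val_inj->] /= := ltngtP b a.
    rewrite ltnNge (ltnW (f_homo lt)) /= => /andP[/eqP e _].
    by have := f_homo lt; rewrite e ltnn.
  by rewrite ltnn eqxx /= => ca; rewrite -!val_eqE /= !gtn_eqF // (ltn_trans ca).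
rewrite [X in (_ < X)%N]term_mnm_w (bigD1 a) //= !eqxx.
rewrite term_mnm_w big1 // => b _.
case: (ltngtP b a) => [lt|lt|/val_inj->].
- case: eqP => // e; by have := f_homo lt; rewrite e ltnn.
- case: eqP => // e; by have := f_homo lt; rewrite e ltnn.
- by rewrite eqxx -val_eqE /= gtn_eqF.
Qed.

(** For a fixed h the terms add up to a multiple of a determinant with rows
    indexed by h, which has two equal rows unless h is injective. *)
Lemma subst_minor_expand :
  subst_mul r (\det (\matrix_(a, b) xvar k (f a) (g b)))
  = \sum_(h : {ffun 'I_l -> 'I_r} | injectiveb h)
      \sum_(s : 'S_l) (-1) ^+ s *: 'X_[term_mnm h s] :> T.
Proof.
have termE (h : {ffun 'I_l -> 'I_r}) (s : 'S_l) :
    'X_[term_mnm h s] = \prod_a (wvar k n (f a) (h a) * vvar k m (h a) (g (s a))).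
  rewrite (big_morph _ (@mpolyXD _ k) (mpolyX0 _ k)); apply: eq_bigr => a _.
  by rewrite mpolyXD.
rewrite -det_map_mx.
transitivity (\sum_(h : {ffun 'I_l -> 'I_r}) \sum_(s : 'S_l)
    (-1) ^+ s *: 'X_[term_mnm h s] : T).
  rewrite exchange_big; apply: eq_bigr => s _; rewrite -scaler_sumr.
  rewrite scaler_sign -mulr_sign; congr (_ * _).
  under [RHS]eq_bigr => h _ do rewrite termE.
  rewrite -(bigA_distr_bigA (fun a c => wvar k n (f a) c * vvar k m c (g (s a)))).
  by apply: eq_bigr => a _; rewrite !mxE /= subst_mulX.
rewrite [RHS]big_mkcond; apply: eq_bigr => h _.
case: ifPn => // /injectivePn[a [b neq_ab hab]].
transitivity ((\prod_a wvar k n (f a) (h a))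
  * \det (\matrix_(a, b) vvar k m (h a) (g b))).
  rewrite mulr_sumr; apply: eq_bigr => s _.
  rewrite scaler_sign -mulr_sign termE big_split mulrCA; congr (_ * (_ * _)).
  by apply: eq_bigr => c _; rewrite mxE.
by rewrite (determinant_alternate neq_ab) ?mulr0 // => c; rewrite !mxE hab.
Qed.

Lemma mlead_subst_minor :
  let p := subst_mul r (\det (\matrix_(a, b) xvar k (f a) (g b))) in
  mlead p = diag_mnm /\ p != 0.
Proof.
move=> p.
pose idh := [ffun a => widen_ord le_lr a].
have idE s : term_mnm idh s = term_mnm (widen_ord le_lr) s.
  by apply: eq_bigr => a _; rewrite ffunE.
have idI : injectiveb idh.
  by apply/injectiveP => a b; rewrite !ffunE => /(congr1 val) e; exact: val_inj.
have lt (h : {ffun 'I_l -> 'I_r}) (s : 'S_l) : injectiveb h -> (h, s) != (idh, 1%g) ->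
    (term_mnm h s < diag_mnm)%O.
  move=> /injectiveP hI neq; apply: term_mnm_lt => //.
  apply: contra neq => /forallP e; apply/eqP; congr (_, _).
    by apply/ffunP => a; rewrite ffunE; have /andP[/eqP] := e a.
  by apply/permP => a; rewrite perm1; have /andP[_ /eqP] := e a.
have pE : p = \sum_(hs : {ffun 'I_l -> 'I_r} * 'S_l | injectiveb hs.1)
    (-1) ^+ hs.2 *: 'X_[term_mnm hs.1 hs.2].
  rewrite /p subst_minor_expand pair_big_dep /=.
  by apply: eq_bigl => hs; rewrite andbT.
have one : term_mnm idh (1%g : 'S_l) = diag_mnm.
  by rewrite idE; apply: eq_bigr => a _; rewrite perm1.
have pD : p@_diag_mnm = 1.
  rewrite pE raddf_sum (bigD1 (idh, 1%g)) //= big1 => [|[h s] /andP[/= hI neq]].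
    by rewrite odd_perm1 scale1r one mcoeffX eqxx addr0.
  by rewrite mcoeffZ mcoeffX lt_eqF ?mulr0 // lt.
split; last first.
  by apply/eqP => p0; move/eqP: pD; rewrite p0 mcoeff0 eq_sym oner_eq0.
apply: mlead_monic => // x; rewrite pE => /msupp_sum_le /flattenP[xs /mapP[[h s] + ->]].
rewrite mem_filter => /andP[/= hI _] /msuppZ_le; rewrite msuppX inE => /eqP->.
have [[-> ->]|/eqP neq] := (h, s) =P (idh, 1%g); first by rewrite one.
exact/ltW/lt.
Qed.

End Minor.

(** * Bideterminants *)

Lemma in_ideal_gen_mull (R : comNzRingType) (G : R -> Prop) (a p : R) :
  in_ideal_gen G p -> in_ideal_gen G (a * p).
Proof. by move=> Gp; rewrite -[_ * _]addr0; apply/in_ideal_genMD/in_ideal_gen0. Qed.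

Lemma in_ideal_gen_sum (R : comNzRingType) (G : R -> Prop) (I : Type) (s : seq I)
    (P : pred I) (F : I -> R) :
  (forall i, P i -> in_ideal_gen G (F i)) -> in_ideal_gen G (\sum_(i <- s | P i) F i).
Proof.
move=> GF; elim/big_ind: _ => // [|p q Gp Gq]; first exact: in_ideal_gen0.
by rewrite -[p]mul1r; apply: in_ideal_genMD.
Qed.

(** Laplace expansion along the first row lowers the size down to t. *)
Lemma det_in_minor_ideal (k : fieldType) (m n t l : nat)
    (f : 'I_l -> 'I_m) (g : 'I_l -> 'I_n) : (t <= l)%N ->
    {homo f : a b / (a < b)%N} -> {homo g : a b / (a < b)%N} ->
  in_ideal_gen (@is_minor k m n t) (\det (\matrix_(a, b) xvar k (f a) (g b))).
Proof.
move=> le_tl; rewrite -(subnK le_tl) in f g *.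
elim: (l - t)%N f g => [|d IH] f g hf hg.
  exists [:: (1, \det (\matrix_(a, b) xvar k (f a) (g b)))].
  split; last by rewrite big_seq1 mul1r.
  by move=> c; rewrite inE => /eqP-> /=; exists f, g.
rewrite (expand_det_row _ ord0); apply: in_ideal_gen_sum => j _.
apply: in_ideal_gen_mull; apply: in_ideal_gen_mull.
have lift_homo (x : 'I_(d.+1 + t)) : {homo lift x : a b / (a < b)%N}.
  by move=> a b; rewrite /= /bump; lia.
rewrite (_ : row' _ _ = \matrix_(a, b) xvar k (f (lift ord0 a)) (g (lift j b))).
  by apply: IH => a b ab; [apply/hf/lift_homo|apply/hg/lift_homo].
by apply/matrixP => a b; rewrite !mxE.
Qed.

Lemma homog_prod (R : comNzRingType) (n : nat) (I : Type) (s : seq I) (P : pred I)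
    (d : I -> nat) (F : I -> {mpoly R[n]}) : (forall i, F i \is (d i).-homog) ->
  \prod_(i <- s | P i) F i \is (\sum_(i <- s | P i) d i).-homog.
Proof.
move=> hF; elim/big_rec2: _ => [|i d' p _ hp]; first exact: dhomog1.
exact: dhomogM.
Qed.

(** Distinct leading monomials cannot cancel: the largest one survives. *)
Lemma mlead_lincomb (k : fieldType) (n : nat) (I : finType) (F : I -> {mpoly k[n]})
    (c : I -> k) :
    (forall i, c i != 0 -> F i != 0) ->
    (forall i j, c i != 0 -> c j != 0 -> mlead (F i) = mlead (F j) -> i = j) ->
    forall i1, c i1 != 0 ->
  exists i0, [/\ c i0 != 0, \sum_i c i *: F i != 0
               & mlead (\sum_i c i *: F i) = mlead (F i0)].
Proof.
move=> F0 F_inj i1 ci1; set p := \sum_i _.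
case: (@Order.TotalTheory.arg_maxP _ _ _ i1 (fun i => c i != 0) (fun i => mlead (F i)) ci1).
move=> i0 ci0 max; exists i0.
have pD : p@_(mlead (F i0)) != 0.
  rewrite raddf_sum (bigD1 i0) //= big1 => [|i neq].
    by rewrite addr0 mcoeffZ mulf_neq0 // mleadc_eq0 F0.
  have [->|ci] := eqVneq (c i) 0; first by rewrite scale0r mcoeff0.
  rewrite mcoeffZ mcoeff_gt_mlead ?mulr0 // lt_neqAle; apply/andP; split; last exact: max.
  by apply: contra neq => /eqP /F_inj -> //.
have p0 : p != 0 by apply/eqP => p0; rewrite p0 mcoeff0 eqxx in pD.
split=> //; apply/le_anti/andP; split; last by rewrite msupp_le_mlead // mcoeff_msupp.
have /msupp_sum_le/flattenP[xs /mapP[i _ ->]] := mlead_supp p0.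
have [->|ci] := eqVneq (c i) 0; first by rewrite scale0r msupp0.
by move=> /msuppZ_le/msupp_le_mlead/le_trans; apply; apply: max.
Qed.

Section Bideterminant.

Variables (k : fieldType) (m n : nat) (i0 : 'I_m) (j0 : 'I_n).

Notation S := {mpoly k[m * n]}.

(** Indices are natural numbers so that minors of provably equal sizes can be
    compared without casts; out of range they default to i0 and j0. *)
Definition minor_at (l : nat) (f g : nat -> nat) : S :=
  \det (\matrix_(a < l, b < l) xvar k (insubd i0 (f a)) (insubd j0 (g b))).

Lemma minor_at_ext l f f' g g' : (forall a, (a < l)%N -> f a = f' a) ->
  (forall a, (a < l)%N -> g a = g' a) -> minor_at l f g = minor_at l f' g'.
Proof.
move=> ef eg; congr (\det _); apply/matrixP => a b.
by rewrite !mxE ef ?eg.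
Qed.

Lemma minor_at_homog l f g : minor_at l f g \is l.-homog.
Proof.
apply: rpred_sum => s _; rewrite mulr_sign.
have : \prod_(a < l) (\matrix_(a < l, b < l)
    xvar k (insubd i0 (f a)) (insubd j0 (g b))) a (s a) \is l.-homog.
  rewrite -[X in _ \is X.-homog]card_ord -sum1_card; apply: homog_prod => a.
  by rewrite !mxE dhomogX /= mdeg1.
by case: ifP => // _; rewrite dhomogN.
Qed.

Definition mnm_fun (N : 'X_{1..m * n}) (i j : nat) : nat :=
  N (mxvec_index (insubd i0 i) (insubd j0 j)).

(** The far sides of the growth diagram of the exponent matrix of N.  Both end
    at the partition at (m, n), so they encode two tableaux of this shape. *)
Definition row_chain N (i : nat) := growth (mnm_fun N) i n.
Definition col_chain N (j : nat) := growth (mnm_fun N) m j.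
Definition shape N := growth (mnm_fun N) m n.

Lemma row_chainP N : gelfand_tsetlin (row_chain N).
Proof.
by split=> [//|i]; have [] := growth_hstrip (mnm_fun N) i n.
Qed.

Lemma col_chainP N : gelfand_tsetlin (col_chain N).
Proof.
by split=> [a|j]; [rewrite /col_chain growth0
  |have [] := growth_hstrip (mnm_fun N) m j].
Qed.

Definition column_length N := conjugate (shape N) m.

Lemma column_length_gt N c a : (a < column_length N c)%N = (c < shape N a)%N.
Proof. exact: (conjugate_gt (row_chainP N)). Qed.

Lemma column_length_nonincr N c : (column_length N c <= column_length N 0)%N.
Proof.
rewrite leqNgt column_length_gt; apply/negP => /(leq_ltn_trans (leq0n c)).
by rewrite -column_length_gt ltnn.
Qed.

Definition column_minor N c : S :=
  minor_at (column_length N c) (entry (row_chain N) m c) (entry (col_chain N) n c).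

(** The standard bideterminant that the Robinson-Schensted-Knuth
    correspondence attaches to the monomial with exponents N. *)
Definition bidet N : S := \prod_(c < shape N 0) column_minor N c.

Lemma insubd_entry_row N c (a : 'I_(column_length N c)) :
  insubd i0 (entry (row_chain N) m c a) = entry (row_chain N) m c a :> nat.
Proof.
rewrite insubdK // unfold_in /=; apply: (entry_lt (row_chainP N)).
by rewrite -[row_chain N m]/(shape N) -column_length_gt.
Qed.

Lemma insubd_entry_col N c (a : 'I_(column_length N c)) :
  insubd j0 (entry (col_chain N) n c a) = entry (col_chain N) n c a :> nat.
Proof.
rewrite insubdK // unfold_in /=; apply: (entry_lt (col_chainP N)).
by rewrite -[col_chain N n]/(shape N) -column_length_gt.
Qed.

Lemma entry_row_homo N c :
  {homo (fun a : 'I_(column_length N c) => insubd i0 (entry (row_chain N) m c a))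
    : a b / (a < b)%N}.
Proof.
move=> a b ab; rewrite !insubd_entry_row; apply: (entry_mono (row_chainP N)) => //.
by rewrite -[row_chain N m]/(shape N) -column_length_gt.
Qed.

Lemma entry_col_homo N c :
  {homo (fun a : 'I_(column_length N c) => insubd j0 (entry (col_chain N) n c a))
    : a b / (a < b)%N}.
Proof.
move=> a b ab; rewrite !insubd_entry_col; apply: (entry_mono (col_chainP N)) => //.
by rewrite -[col_chain N n]/(shape N) -column_length_gt.
Qed.

(** The first column is the longest, and its minor is already in the ideal. *)
Lemma bidet_in_minor_ideal N t : (0 < t <= column_length N 0)%N ->
  in_ideal_gen (@is_minor k m n t) (bidet N).
Proof.
case/andP=> t0 le; have pos : (0 < shape N 0)%N by rewrite -column_length_gt (leq_trans t0).
rewrite /bidet (bigD1 (Ordinal pos)) //= mulrC; apply: in_ideal_gen_mull.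
by apply: det_in_minor_ideal le _ _; [apply: entry_row_homo|apply: entry_col_homo].
Qed.

(** Row a of the first tableau has row_chain N i.+1 a - row_chain N i a entries
    equal to i, and each of them contributes a factor w_(i,a) through the
    diagonal term of the minor of its column. *)
Lemma mlead_bidet r N : (column_length N 0 <= r)%N ->
  [/\ subst_mul r (bidet N) != 0,
      forall i a, mlead (subst_mul r (bidet N)) (windex n i a)
        = (row_chain N i.+1 a - row_chain N i a)%N
    & forall a j, mlead (subst_mul r (bidet N)) (vindex m a j)
        = (col_chain N j.+1 a - col_chain N j a)%N].
Proof.
move=> le_r.
have le c : (column_length N c <= r)%N by apply: leq_trans (column_length_nonincr N c) le_r.
have lead c := mlead_subst_minor k (le c) (@entry_row_homo N c) (@entry_col_homo N c).
have nz c : subst_mul r (column_minor N c) != 0 by have [] := lead c.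
have E : subst_mul r (bidet N) = \prod_(c < shape N 0) subst_mul r (column_minor N c).
  exact: rmorph_prod.
(* Only row b = a of a column can contribute to the exponent of w_(i,a). *)
have delta l (F : nat -> bool) (a : nat) :
    (\sum_(b < l) (F b && (b == a :> nat)) = (a < l) && F a)%N.
  have [lt|ge] := ltnP a l; last first.
    by rewrite big1 // => b _; rewrite ltn_eqF ?andbF // (leq_trans _ ge).
  rewrite (bigD1 (Ordinal lt)) //= eqxx andbT big1 ?addn0 // => b.
  by rewrite -val_eqE /= => /negbTE->; rewrite andbF.
have leadE x : mlead (subst_mul r (bidet N)) x =
    (\sum_(c < shape N 0) mlead (subst_mul r (column_minor N c)) x)%N.
  by rewrite E mlead_prod ?mnm_sumE.
split; first by rewrite E; apply/prodf_neq0 => c _.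
- move=> i a.
  have le_shape : (row_chain N i.+1 a <= shape N a)%N.
    exact: (chain_homo (row_chainP N) a (ltn_ord i)).
  rewrite leadE -[RHS](@sum_interval _ _ (shape N 0)); first last.
  + exact: leq_trans le_shape (chain_nonincr (row_chainP N) m (leq0n a)).
  + exact: (chain_homo (row_chainP N)).
  apply: eq_bigr => c _; rewrite /column_minor (proj1 (lead c)) term_mnm_w.
  transitivity (\sum_(b < column_length N c) ((entry (row_chain N) m c b == i)
      && (b == a :> nat)))%N.
    by apply: eq_bigr => b _; rewrite -!val_eqE /= insubd_entry_row.
  rewrite (delta _ (fun b => entry _ _ _ b == i)) column_length_gt.
  by rewrite (entry_eq (row_chainP N)) //; move: le_shape; lia.
- move=> a j.
  have le_shape : (col_chain N j.+1 a <= shape N a)%N.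
    exact: (chain_homo (col_chainP N) a (ltn_ord j)).
  rewrite leadE -[RHS](@sum_interval _ _ (shape N 0)); first last.
  + exact: leq_trans le_shape (chain_nonincr (col_chainP N) n (leq0n a)).
  + exact: (chain_homo (col_chainP N)).
  apply: eq_bigr => c _; rewrite /column_minor (proj1 (lead c)) term_mnm_v.
  transitivity (\sum_(b < column_length N c) ((entry (col_chain N) n c b == j)
      && (b == a :> nat)))%N.
    by apply: eq_bigr => b _; rewrite -!val_eqE /= insubd_entry_col andbC.
  rewrite (delta _ (fun b => entry _ _ _ b == j)) column_length_gt.
  by rewrite (entry_eq (col_chainP N)) //; move: le_shape; lia.
Qed.

(** The leading monomial gives the successive differences in rows a < r of both
    chains; the rows a >= r are empty by the bound on the columns. *)
Lemma mlead_bidet_inj r N N' : (column_length N 0 <= r)%N -> (column_length N' 0 <= r)%N ->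
  mlead (subst_mul r (bidet N)) = mlead (subst_mul r (bidet N')) -> N = N'.
Proof.
move=> lN lN' e.
have [_ Nw Nv] := mlead_bidet lN; have [_ Nw' Nv'] := mlead_bidet lN'.
have shape0 M a : (column_length M 0 <= r)%N -> (r <= a)%N -> shape M a = 0%N.
  by move=> lM ra; apply/eqP; rewrite -leqn0 leqNgt -column_length_gt -leqNgt (leq_trans lM).
apply/mnmP => x; case/mxvec_indexP: x => i j.
suff : mnm_fun N i j = mnm_fun N' i j by rewrite /mnm_fun !valKd.
apply: (@growth_inj _ _ m n) => // {i j} [i le_i|j le_j] a.
  have [lt_ar|le_ra] := ltnP a r; last first.
    have z M : (column_length M 0 <= r)%N -> row_chain M i a = 0%N.
      move=> lM; apply/eqP; rewrite -leqn0 -(shape0 M a lM le_ra).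
      exact: (chain_homo (row_chainP M)).
    by rewrite -[LHS]/(row_chain N i a) -[RHS]/(row_chain N' i a) !z.
  elim: i le_i => [//|i IH] lt_i; have {}IH := IH (ltnW lt_i).
  have := Nw (Ordinal lt_i) (Ordinal lt_ar); rewrite e Nw' /=.
  have := chain_homo (row_chainP N) a (leqnSn i).
  have := chain_homo (row_chainP N') a (leqnSn i).
  by move: IH; rewrite /row_chain; lia.
have [lt_ar|le_ra] := ltnP a r; last first.
  have z M : (column_length M 0 <= r)%N -> col_chain M j a = 0%N.
    move=> lM; apply/eqP; rewrite -leqn0 -(shape0 M a lM le_ra).
    exact: (chain_homo (col_chainP M)).
  by rewrite -[LHS]/(col_chain N j a) -[RHS]/(col_chain N' j a) !z.
elim: j le_j => [|j IH] lt_j; first by rewrite !growth0.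
have {}IH := IH (ltnW lt_j).
have := Nv (Ordinal lt_ar) (Ordinal lt_j); rewrite e Nv' /=.
have := chain_homo (col_chainP N) a (leqnSn j).
have := chain_homo (col_chainP N') a (leqnSn j).
by move: IH; rewrite /col_chain; lia.
Qed.

(** The degree of the product is the number of boxes of the shape, which by
    growth_sum is the sum of all the exponents. *)
Lemma bidet_homog N : bidet N \is (mdeg N).-homog.
Proof.
have -> : mdeg N = (\sum_(c < shape N 0) column_length N c)%N.
  have lenE (c : 'I_(shape N 0)) : column_length N c = (\sum_(a < m.+1) (0 <= c < shape N a))%N.
    have le : (column_length N c <= m.+1)%N by apply/leqW/conjugate_le.
    rewrite -[LHS]subn0 -(sum_interval (leq0n _) le); apply: eq_bigr => a _.
    by rewrite column_length_gt.
  under eq_bigr => c _ do rewrite lenE.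
  rewrite exchange_big (eq_bigr (fun a : 'I_m.+1 => shape N a)) => [|a _]; last first.
    by rewrite sum_interval ?subn0 //; apply: (chain_nonincr (row_chainP N) m).
  rewrite -(big_mkord predT (shape N)) growth_sum // mdegE big_mkord.
  rewrite (reindex _ (curry_mxvec_bij m n)) /=.
  rewrite (eq_bigr (fun p : 'I_m * 'I_n => mnm_fun N p.1 p.2)) => [|[i j] _]; last first.
    by rewrite /mnm_fun !valKd.
  rewrite -(pair_bigA _ (fun (i : 'I_m) (j : 'I_n) => mnm_fun N i j)) /=.
  by apply: eq_bigr => i _; rewrite big_mkord.
by apply: homog_prod => c; apply: minor_at_homog.
Qed.

Lemma lincomb_bidet_neq0 (r b : nat) (c : 'X_{1..(m * n)%N < b} -> k) N1 :
  (forall N, c N != 0 -> (column_length N 0 <= r)%N) -> c N1 != 0 ->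
  exists N0, [/\ c N0 != 0, \sum_N c N *: subst_mul r (bidet N) != 0
     & mlead (\sum_N c N *: subst_mul r (bidet N)) = mlead (subst_mul r (bidet N0))].
Proof.
move=> cr; apply: mlead_lincomb => [N cN|N N' cN cN' e].
  by have [] := mlead_bidet (cr N cN).
exact/val_inj/(mlead_bidet_inj (cr N cN) (cr N' cN') e).
Qed.

(** In degrees below b there are as many bideterminants as monomials, and they
    are independent: their images under the substitution with r = m have
    distinct leading monomials, since no column is longer than m. *)
Lemma bidet_span (p : S) :
  exists b (c : 'X_{1..(m * n)%N < b} -> k), p = \sum_N c N *: bidet N.
Proof.
pose b := msize p; exists b.
pose I := 'X_{1..(m * n)%N < b} : finType.
pose ev (j : 'I_#|I|) : 'X_{1..(m * n)%N < b} := enum_val j.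
have evK j : enum_rank (ev j : I) = j by exact: enum_valK.
pose A : 'M[k]_#|I| :=
  \matrix_(i, j) (bidet (ev i))@_(ev j).
have coefE (q : S) : (forall x, (b <= mdeg x)%N -> q@_x = 0) ->
    (forall j : 'I_#|I|, q@_(ev j) = 0) -> q = 0.
  move=> hi lo; apply/mpolyP => x; rewrite mcoeff0.
  have [/hi//|lt] := leqP b (mdeg x).
  by have := lo (enum_rank (BMultinom lt : I)); rewrite /ev enum_rankK.
have high (c : 'X_{1..(m * n)%N < b} -> k) x : (b <= mdeg x)%N ->
    (\sum_N c N *: bidet N)@_x = 0.
  move=> bx; rewrite raddf_sum big1 // => N _.
  rewrite /= mcoeffZ (dhomog_nemf_coeff (bidet_homog N)) ?mulr0 //.
  by rewrite gtn_eqF // (leq_trans (bmdeg N)).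
have sumE (v : 'rV[k]_#|I|) j :
    (\sum_N v 0 (enum_rank N) *: bidet N)@_(ev j) = (v *m A) 0 j.
  rewrite raddf_sum mxE (reindex ev) /=; last exact/onW_bij/enum_val_bij.
  by apply: eq_bigr => i _; rewrite /= mcoeffZ evK mxE.
have A_unit : A \in unitmx.
  rewrite -row_free_unit; apply/inj_row_free => v vA0; apply/rowP => i; rewrite mxE.
  apply/eqP; apply: contraT => vi.
  have q0 : \sum_N v 0 (enum_rank N) *: bidet N = 0.
    by apply: coefE => [x|j]; [apply: high|rewrite sumE vA0 mxE].
  have := @lincomb_bidet_neq0 m b (fun N => v 0 (enum_rank N)) (ev i).
  rewrite evK => /(_ (fun _ _ => conjugate_le _ _ _) vi)[N0 [_ + _]].
  (* The substitution is pulled out of the sum, which then vanishes. *)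
  rewrite (eq_bigr (fun N : I =>
    subst_mul m (v 0 (enum_rank N) *: bidet N))) => [|N _]; last by rewrite linearZ.
  by rewrite -rmorph_sum q0 rmorph0 eqxx.
pose u : 'rV[k]_#|I| := \row_j p@_(ev j).
exists (fun N => (u *m invmx A) 0 (enum_rank N)).
apply/eqP; rewrite -subr_eq0; apply/eqP; apply: coefE => [x bx|j].
  rewrite mcoeffB high // subr0; apply/eqP; rewrite mcoeff_eq0.
  exact: msize_mdeg_ge.
by rewrite mcoeffB sumE mulmxKV // mxE subrr.
Qed.

(** Bideterminants with a column longer than r are dropped modulo the ideal. *)
Lemma subst_normal_form (r : nat) (p : S) :
  exists b (c : 'X_{1..(m * n)%N < b} -> k),
    [/\ forall N, c N != 0 -> (column_length N 0 <= r)%N,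
        in_ideal_gen (@is_minor k m n r.+1) (p - \sum_N c N *: bidet N)
      & subst_mul r p = \sum_N c N *: subst_mul r (bidet N)].
Proof.
have [b [c pE]] := bidet_span p.
exists b, (fun N : 'X_{1..(m * n)%N < b} => if (column_length N 0 <= r)%N then c N else 0).
set p' := \sum_N _.
have pp' : in_ideal_gen (@is_minor k m n r.+1) (p - p').
  rewrite {1}pE -sumrB; apply: in_ideal_gen_sum => N _.
  case: leqP => [_|lt]; first by rewrite subrr; apply: in_ideal_gen0.
  rewrite scale0r subr0 -mul_mpolyC; apply: in_ideal_gen_mull.
  exact: bidet_in_minor_ideal.
split=> //; first by move=> N; case: ifP => //; rewrite eqxx.
have : subst_mul r (p - p') = 0.
  by apply: in_ideal_gen_ker pp' => q; apply: subst_mul_minor.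
rewrite rmorphB => /eqP; rewrite subr_eq0 => /eqP->.
by rewrite rmorph_sum; apply: eq_bigr => N _ /=; rewrite linearZ.
Qed.

Lemma subst_mul_kernel (r : nat) (p : S) :
  subst_mul r p = 0 -> in_ideal_gen (@is_minor k m n r.+1) p.
Proof.
have [b [c [cr pI pE]]] := subst_normal_form r p => p0.
suff c0 N : c N = 0.
  by move: pI; rewrite big1 ?subr0 // => N _; rewrite c0 scale0r.
apply/eqP; apply: contraT => cN.
by have [N0 [_]] := lincomb_bidet_neq0 cr cN; rewrite -pE p0 eqxx.
Qed.

(** The hypotheses say that row a of either tableau contains an a, for all
    a < r, so the first column is (0, ..., r-1) in both. *)
Lemma bidet_dvd (r : nat) N : (0 < r)%N -> (r <= m)%N -> (r <= n)%N ->
    (column_length N 0 <= r)%N ->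
    (forall a, (a < r)%N -> (0 < row_chain N a.+1 a)%N) ->
    (forall a, (a < r)%N -> (0 < col_chain N a.+1 a)%N) ->
  exists B, bidet N = minor_at r id id * B.
Proof.
move=> r0 rm rn le_r row_pos col_pos.
have pos a : (a < r)%N -> (0 < shape N a)%N.
  move=> ar; apply: leq_trans (row_pos a ar) _.
  exact: (chain_homo (row_chainP N) a (leq_trans ar rm)).
have len : column_length N 0 = r.
  apply/eqP; rewrite eqn_leq le_r -(prednK r0) column_length_gt.
  by rewrite pos // prednK.
exists (\prod_(c < shape N 0 | c != Ordinal (pos 0 r0)) column_minor N c).
rewrite /bidet (bigD1 (Ordinal (pos 0 r0))) //=; congr (_ * _).
rewrite /column_minor len; apply: minor_at_ext => a ar.
  by rewrite (entry_diag (row_chainP N)) ?row_pos // (leq_trans ar).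
by rewrite (entry_diag (col_chainP N)) ?col_pos // (leq_trans ar).
Qed.

Section Cancel.

Variable r : nat.
Hypotheses (r_gt0 : (0 < r)%N) (le_rm : (r <= m)%N) (le_rn : (r <= n)%N).

Definition corner_minor : S := minor_at r id id.

(** The leading monomial is the product of the w_(a,a) v_(a,a). *)
Lemma mlead_corner_minor :
  [/\ subst_mul r corner_minor != 0,
      forall a, (0 < mlead (subst_mul r corner_minor) (windex n (widen_ord le_rm a) a))%N
    & forall a, (0 < mlead (subst_mul r corner_minor) (vindex m a (widen_ord le_rn a)))%N].
Proof.
have fE (a : 'I_r) : insubd i0 (a : nat) = widen_ord le_rm a.
  by apply: val_inj; rewrite insubdK // unfold_in /= (leq_trans (ltn_ord a)).
have gE (a : 'I_r) : insubd j0 (a : nat) = widen_ord le_rn a.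
  by apply: val_inj; rewrite insubdK // unfold_in /= (leq_trans (ltn_ord a)).
have [|a b ab|-> nz] := @mlead_subst_minor k m n r r (fun a => insubd i0 (a : nat))
   (fun a => insubd j0 (a : nat)) (leqnn r); rewrite ?fE ?gE //.
  by move=> a b ab; rewrite !fE.
split=> // a; rewrite ?term_mnm_w ?term_mnm_v (bigD1 a) //= -?fE -?gE eqxx.
  by rewrite -val_eqE /= eqxx.
by rewrite -val_eqE /= eqxx.
Qed.

(** In the normal form of p, the leading monomial comes from a bideterminant
    which the corner minor divides.  Removing its term keeps the equation, with
    another h, and shortens the normal form. *)
Lemma subst_mul_cancel (p : S) (h : {mpoly k[m * r + r * n]}) :
    subst_mul r p = subst_mul r corner_minor * h ->
  exists q, h = subst_mul r q.
Proof.
have [b [c [cr _ ->]]] := subst_normal_form r p.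
have [d0 dw dv] := mlead_corner_minor.
have [s] := ubnP #|[pred N | c N != 0]|.
elim: s c cr h => // s IH c cr h /ltnSE le_s eh.
have [/existsP[N1 cN1]|] := boolP [exists N, c N != 0]; last first.
  rewrite negb_exists => /forallP c0; exists 0; rewrite rmorph0.
  move: eh; rewrite big1 => [/esym/eqP|N _].
    by rewrite mulf_eq0 (negbTE d0) => /eqP.
  by have := c0 N; rewrite negbK => /eqP->; rewrite scale0r.
have [N0 [cN0 nz]] := lincomb_bidet_neq0 cr cN1.
rewrite eh in nz *; rewrite mulf_eq0 negb_or d0 /= in nz.
rewrite mleadM // => lead.
have [_ lw lv] := mlead_bidet (cr _ cN0).
have [||B BE] := @bidet_dvd r N0 r_gt0 le_rm le_rn (cr _ cN0).
- move=> a ar; have := lw (widen_ord le_rm (Ordinal ar)) (Ordinal ar).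
  rewrite -lead mnmDE /= => e; apply: leq_trans (leq_subr (row_chain N0 a a) _).
  by rewrite -e addn_gt0 dw.
- move=> a ar; have := lv (Ordinal ar) (widen_ord le_rn (Ordinal ar)).
  rewrite -lead mnmDE /= => e; apply: leq_trans (leq_subr (col_chain N0 a a) _).
  by rewrite -e addn_gt0 dv.
pose c' N := if N == N0 then 0 else c N.
have cr' N : c' N != 0 -> (column_length N 0 <= r)%N.
  by rewrite /c'; case: ifP => _; [rewrite eqxx|apply: cr].
have [|| q qE] := IH c' cr' (h - c N0 *: subst_mul r B).
- apply: leq_trans le_s; apply: proper_card; apply/properP; split.
    by apply/subsetP => N; rewrite !inE /c'; case: ifP; rewrite ?eqxx.
  by exists N0; rewrite !inE /c' ?eqxx.
- rewrite mulrBr -eh (bigD1 N0) //= /c' eqxx scale0r add0r.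
  rewrite [in RHS](bigD1 N0) //= -scalerAr -rmorphM -BE [RHS]addrC addKr.
  by apply: eq_bigr => N /negbTE ->.
by exists (q + c N0 *: B); rewrite rmorphD /= linearZ /= -qE subrK.
Qed.

Lemma subst_mul_cancelX e (p : S) (h : {mpoly k[m * r + r * n]}) :
    subst_mul r p = subst_mul r corner_minor ^+ e * h ->
  exists q, h = subst_mul r q.
Proof.
elim: e p => [|e IH] p; first by rewrite expr0 mul1r => <-; exists p.
by rewrite exprS -mulrA => /subst_mul_cancel[q /esym/IH].
Qed.

(** A generic m x n matrix X of rank r is the product of X1 X11^-1 and its first
    r rows, so this evaluates p on a factorisation that is rational in X.  The
    denominators are powers of det X11; the polynomials p whose denominator can
    be cleared form a subalgebra, and Cramer's rule handles the coordinates. *)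
Lemma localised_eval (p : {mpoly k[m * r + r * n]}) :
  exists e (q : S), forall X : 'M[k]_(m, n),
    let X11 := mxsub (widen_ord le_rm) (widen_ord le_rn) X in
    \det X11 != 0 ->
    q.@[mxvec X 0] = \det X11 ^+ e *
     p.@[coords (colsub (widen_ord le_rn) X *m invmx X11, rowsub (widen_ord le_rm) X)].
Proof.
pose loc (p : {mpoly k[m * r + r * n]}) (X : 'M[k]_(m, n)) :=
  p.@[coords (colsub (widen_ord le_rn) X *m invmx (mxsub (widen_ord le_rm) (widen_ord le_rn) X),
    rowsub (widen_ord le_rm) X)].
pose dX (X : 'M[k]_(m, n)) := \det (mxsub (widen_ord le_rm) (widen_ord le_rn) X).
pose good p := exists e (q : S), forall X, dX X != 0 -> q.@[mxvec X 0] = dX X ^+ e * loc p X.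
rewrite -/(good p).
pose Xg : 'M[S]_(m, n) := \matrix_(i, j) xvar k i j.
have XgE X : map_mx (meval (mxvec X 0)) Xg = X.
  by apply/matrixP => i j; rewrite !mxE mevalXU mxvecE.
pose dg := \det (mxsub (widen_ord le_rm) (widen_ord le_rn) Xg).
have dgE X : dg.@[mxvec X 0] = dX X.
  by rewrite -det_map_mx map_mxsub XgE.
have goodC a : good a%:MP.
  by exists 0, a%:MP => X _; rewrite /loc !mevalC mul1r.
have goodM q1 q2 : good q1 -> good q2 -> good (q1 * q2).
  move=> [e1 [s1 E1]] [e2 [s2 E2]]; exists (e1 + e2)%N, (s1 * s2) => X dX0.
  by rewrite mevalM E1 // E2 // /loc mevalM exprD mulrACA.
have goodD q1 q2 : good q1 -> good q2 -> good (q1 + q2).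
  move=> [e1 [s1 E1]] [e2 [s2 E2]].
  exists (e1 + e2)%N, (dg ^+ e2 * s1 + dg ^+ e1 * s2) => X dX0.
  rewrite mevalD !mevalM !rmorphXn /= dgE E1 // E2 // /loc mevalD mulrDr !mulrA.
  by rewrite -!exprD [(e2 + e1)%N]addnC.
have goodX : forall x, good 'X_x.
  elim/wvindexP => [i c|c j].
    exists 1, ((colsub (widen_ord le_rn) Xg
      *m \adj (mxsub (widen_ord le_rm) (widen_ord le_rn) Xg)) i c) => X dX0.
    rewrite /loc mevalXU /coords row_mxEl mxvecE /=.
    rewrite /invmx unitmxE unitfE dX0 -scalemxAr.
    have -> (a : k) (B : 'M[k]_(m, r)) : (a *: B) i c = a * B i c by rewrite mxE.
    rewrite expr1 mulVKf //.
    have -> (A : 'M[S]_(m, r)) :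
        (A i c).@[mxvec X 0] = map_mx (meval (mxvec X 0)) A i c by rewrite mxE.
    by rewrite map_mxM map_mx_adj !map_mxsub XgE.
  exists 0, (xvar k (widen_ord le_rm c) j) => X dX0.
  by rewrite /loc !mevalXU /coords row_mxEr !mxvecE mxE mul1r.
elim/mpolyind: p => [|a x p _ _ IH]; first by rewrite -mpolyC0.
apply: (goodD) IH; rewrite -mul_mpolyC; apply: (goodM) => //.
rewrite mpolyXE_id; elim/big_ind: _ => [|q1 q2|i _]; first by rewrite -mpolyC1.
  exact: (goodM).
by elim: (x i) => [|y IH]; rewrite ?expr0 -?mpolyC1 // exprS; apply: (goodM).
Qed.

End Cancel.

End Bideterminant.

(** * Invariants *)

Lemma base_expansion_inj (b n : nat) (u v : 'I_n -> nat) :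
    (forall i, u i < b)%N -> (forall i, v i < b)%N ->
  (\sum_(i < n) u i * b ^ i = \sum_(i < n) v i * b ^ i)%N -> u =1 v.
Proof.
elim: n u v => [|n IH] u v ub vb; first by move=> _ [].
have b0 : (0 < b)%N by apply: leq_trans (ub ord0).
have step (w : 'I_n.+1 -> nat) : (\sum_(i < n.+1) w i * b ^ i
    = (\sum_(i < n) w (lift ord0 i) * b ^ i) * b + w ord0)%N.
  rewrite big_ord_recl muln1 addnC; congr (_ + _)%N.
  rewrite big_distrl; apply: eq_bigr => i _.
  by rewrite /= /bump add1n expnSr mulnA.
rewrite !step => e.
have e0 : u ord0 = v ord0.
  by have := congr1 (modn^~ b) e; rewrite /= !modnMDl !modn_small.
move: e; rewrite e0 => /addIn/eqP; rewrite eqn_pmul2r // => /eqP e.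
have eS := IH _ _ (fun i => ub (lift ord0 i)) (fun i => vb (lift ord0 i)) e.
by move=> i; case: (unliftP ord0 i) => [j ->|->]; [apply: eS|].
Qed.

(** Kronecker substitution: for b larger than all exponents, sending variable i
    to the power b ^ i of one variable separates the monomials of p. *)
Lemma mpoly_nonroot (k : closedFieldType) (n : nat) (p : {mpoly k[n]}) :
  p != 0 -> exists v : 'I_n -> k, p.@[v] != 0.
Proof.
move=> p0; pose b := msize p.
pose kappa (x : 'X_{1..n}) := (\sum_(i < n) x i * b ^ i)%N.
have small x i : x \in msupp p -> (x i < b)%N.
  move=> /msize_mdeg_lt; apply: leq_ltn_trans.
  by rewrite mdegE (bigD1 i) //= leq_addr.
pose P := \sum_(x <- msupp p) p@_x *: 'X^(kappa x).
have : P != 0.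
  suff : P`_(kappa (mlead p)) != 0 by apply: contraNneq => ->; rewrite coef0.
  rewrite coef_sum (bigD1_seq (mlead p)) ?mlead_supp ?msupp_uniq //=.
  rewrite coefZ coefXn eqxx mulr1 big_seq_cond big1 ?addr0 ?mleadc_eq0 //.
  move=> x /andP[xp neq]; rewrite coefZ coefXn; case: eqP; rewrite ?mulr0 //.
  move=> /base_expansion_inj e; case/eqP: neq; apply/mnmP => i.
  by rewrite e // => j; apply: small => //; apply: mlead_supp.
case/closed_nonrootP => a; rewrite /root => Pa.
exists (fun i => a ^+ (b ^ i)); apply: contra Pa => /eqP pa; apply/eqP.
rewrite -[RHS]pa mevalE horner_sum; apply: eq_bigr => x _.
rewrite hornerZ hornerXn; congr (_ * _).
by rewrite /kappa -prodrXr; apply: eq_bigr => i _; rewrite mulnC exprM.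
Qed.

(** The identity (phi_r delta)^e p = phi_r q is checked at the points where
    phi_r delta does not vanish; there the corner block of X = W V is W1 V1 with
    both factors invertible, and W1 moves (W, V) to (X1 X11^-1, W1 V). *)
Lemma GLinvariant_image (k : closedFieldType) (m n r : nat)
    (p : {mpoly k[m * r + r * n]}) : (0 < r)%N -> (r <= m)%N -> (r <= n)%N ->
  p \in @GLinvariants k m n r -> exists q, subst_mul r q = p.
Proof.
move=> r0 rm rn /asboolP inv.
have i0 : 'I_m by exact: (Ordinal (leq_trans r0 rm)).
have j0 : 'I_n by exact: (Ordinal (leq_trans r0 rn)).
have [e [q qE]] := localised_eval rm rn p.
pose d := corner_minor k i0 j0 r.
have dE X : d.@[mxvec X 0] = \det (mxsub (widen_ord rm) (widen_ord rn) X).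
  rewrite -det_map_mx; congr (\det _); apply/matrixP => a b.
  rewrite !mxE /= mevalXU mxvecE.
  by congr (X _ _); apply: val_inj; rewrite insubdK // unfold_in /= (leq_trans (ltn_ord _)).
have [nz _ _] := mlead_corner_minor k i0 j0 rm rn.
suff E : subst_mul r q = subst_mul r d ^+ e * p.
  by have [s ->] := subst_mul_cancelX r0 rm rn E; exists s.
apply/eqP; rewrite -subr_eq0; apply: contraT => neq.
(* The extra factor restricts the evaluation to the good points. *)
have [|v] := @mpoly_nonroot _ _ (subst_mul r d * (subst_mul r q - subst_mul r d ^+ e * p)).
  by rewrite mulf_neq0.
pose x : 'M[k]_(m, r) * 'M[k]_(r, n) :=
  (vec_mx (lsubmx (\row_i v i)), vec_mx (rsubmx (\row_i v i))).
have vE : v =1 coords x by move=> i; rewrite /coords !vec_mxK hsubmxK mxE.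
rewrite (meval_eq _ vE) mevalM mevalB mevalM rmorphXn /= !subst_mul_eval.
rewrite mulf_eq0 negb_or => /andP[]; rewrite dE => d0.
rewrite qE //.
pose W1 := rowsub (widen_ord rm) x.1; pose V1 := colsub (widen_ord rn) x.2.
have X11 : mxsub (widen_ord rm) (widen_ord rn) (comp_map x) = W1 *m V1.
  by rewrite /comp_map mxsub_mul.
move: (d0); rewrite X11 det_mulmx mulf_eq0 negb_or => /andP[W0 V0].
have WU : W1 \in unitmx by rewrite unitmxE unitfE.
have VU : V1 \in unitmx by rewrite unitmxE unitfE.
rewrite -(inv W1 WU x) (_ : (_, _) = GLact W1 x) ?subrr ?eqxx //.
rewrite /GLact /comp_map -mul_rowsub_mx -mulmx_colsub; congr (_, _).
have YU : W1 *m V1 \in unitmx by rewrite unitmx_mul WU.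
by apply: (canLR (mulmxK YU)); rewrite mulmxA mulmxKV.
Qed.

Theorem theorem7 (k : closedFieldType) (m n t : nat)
    (t_ge2 : (2 <= t)%N) (t_le_m : (t <= m)%N) (m_le_n : (m <= n)%N) :
  let phi : {lrmorphism det_ring k m n t_ge2
                        -> {mpoly k[m * t.-1 + t.-1 * n]}} :=
    @phi_sharp k m n t t_ge2 in
  injective phi /\
  (forall p : {mpoly k[m * t.-1 + t.-1 * n]},
     (exists q : det_ring k m n t_ge2, phi q = p) <-> p \in @GLinvariants k m n t.-1).
Proof.
move=> phi.
have tE : t.-1.+1 = t by rewrite prednK // ltnW.
have r_gt0 : (0 < t.-1)%N by rewrite -ltnS tE.
have le_rm : (t.-1 <= m)%N by rewrite (leq_trans (leq_pred t)).
have le_rn : (t.-1 <= n)%N := leq_trans le_rm m_le_n.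
split=> [q1 q2 e|p].
  apply/eqP; rewrite -subr_eq0; apply/eqP.
  have : phi (q1 - q2) = 0 by rewrite [LHS](rmorphB phi) [X in X - _]e subrr.
  rewrite -[q1 - q2](det_reprK) /= phi_sharp_pi.
  move=> /(subst_mul_kernel (Ordinal (leq_trans r_gt0 le_rm)) (Ordinal (leq_trans r_gt0 le_rn))).
  rewrite tE => h; rewrite -(rmorph0 (det_pi t_ge2)).
  by apply/det_pi_eq; rewrite subr0.
split=> [[q <-]|/(GLinvariant_image r_gt0 le_rm le_rn)[q <-]].
  apply/asboolP => g gU x; rewrite -[q]det_reprK /= !phi_sharp_eval.
  by rewrite /comp_map /GLact /= mulmxA mulmxKV.
by exists (det_pi t_ge2 q); rewrite /= phi_sharp_pi.
Qed.
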